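(* Let $i\ge 1$, $k\ge 1$, $l\ge 1$ be integers. Then $F(R_{i,0,k,l}) < F(R_{0,0,i+k,l})$.
   Context: All graphs are finite and simple. The F-index of a graph $G$ is $F(G)=\sum_{v\in V(G)} d_G(v)^3$. For integers $i,j\ge 0$ and $k,l\ge 1$, $R_{i,j,k,l}$ is the graph obtained from a triangle $xyz$ by attaching $i$ new leaves to $x$, $j$ new leaves to $y$ and $k$ new pendant vertices to $z$, and then attaching $l$ new leaves to one of the $k$ pendant vertices adjacent to $z$ (attaching a leaf to a vertex means adding a new vertex adjacent only to it). It has $i+j+k+l+3$ vertices. *)

(* Defs.v *)
From mathcomp Require Import all_boot zify.

Set Implicit Arguments.
Unset Strict Implicit.
Unset Printing Implicit Defensive.

Record sgraph := SGraph {
  vertex :> finType;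
  adj : rel vertex;
  adj_sym : symmetric adj;
  adj_irrefl : irreflexive adj
}.

Definition deg (G : sgraph) (v : G) : nat := #|[set u | adj v u]|.

Definition Findex (G : sgraph) : nat := \sum_(v : G) deg v ^ 3.

Section Attach.
Variables (G : sgraph) (v : G) (n : nat).

(* The old vertices are the [inl u], the new ones the [inr a]. *)
Definition attach_adj : rel (G + 'I_n) := fun a b =>
  match a, b with
  | inl u, inl w => adj u w
  | inl u, inr _ | inr _, inl u => u == v
  | inr _, inr _ => false
  end.

Lemma attach_sym : symmetric attach_adj.
Proof. by case=> [u|a] [w|b] //=; rewrite adj_sym. Qed.

Lemma attach_irrefl : irreflexive attach_adj.
Proof. by case=> [u|a] //=; rewrite adj_irrefl. Qed.

Definition attach_leaves : sgraph := SGraph attach_sym attach_irrefl.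
End Attach.

Lemma neq_sym (T : eqType) : symmetric (fun u v : T => u != v).
Proof. by move=> u v; rewrite eq_sym. Qed.

Lemma neq_irrefl (T : eqType) : irreflexive (fun u v : T => u != v).
Proof. by move=> u; rewrite eqxx. Qed.

Definition triangle : sgraph :=
  @SGraph 'I_3 (fun u v => u != v) (@neq_sym _) (@neq_irrefl _).

Definition tri_x : triangle := @Ordinal 3 0 isT.
Definition tri_y : triangle := @Ordinal 3 1 isT.
Definition tri_z : triangle := @Ordinal 3 2 isT.

(* The argument [w] says which of the [k] pendant vertices at [z] receives the
   [l] leaves; it can only be supplied when [0 < k]. *)
Definition Rgraph (i j k l : nat) (w : 'I_k) : sgraph :=
  let G1 := attach_leaves tri_x i in
  let G2 := @attach_leaves G1 (inl tri_y) j in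
  let G3 := @attach_leaves G2 (inl (inl tri_z)) k in
  @attach_leaves G3 (inr w) l.

Arguments Rgraph : clear implicits.

Lemma card_Rgraph i j k l (w : 'I_k) :
  #|Rgraph i j k l w| = i + j + k + l + 3.
Proof. by rewrite /= !card_sum !card_ord; lia. Qed.

(* Main.v *)
Require Import Defs.
From mathcomp Require Import all_boot zify.

(** Attaching [n] leaves to a vertex of degree [d] raises the F-index by [(d + n)^3 - d^3 + n]
    ([Findex_attach]); four such steps from the triangle give a closed form ([Findex_Rgraph]).
    Moving the [i] leaves from [x] to [z] then only replaces the degrees [2 + i] and [2 + k] by [2]
    and [2 + i + k], and the cube is strictly convex. *)

Lemma deg_attach_old (G : sgraph) (v u : G) n :
  deg (inl u : attach_leaves v n) = deg u + (u == v) * n.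
Proof.
rewrite /deg !cardsE -!sum1_card big_sumType /=; congr (_ + _).
rewrite sum1_card; case: eqVneq => [->|neq_uv].
  by rewrite mul1n -[RHS]card_ord; apply: eq_card => a; exact: eqxx.
by apply: eq_card0 => a; exact: negPf neq_uv.
Qed.

Lemma deg_attach_leaf (G : sgraph) (v : G) n (a : 'I_n) :
  deg (inr a : attach_leaves v n) = 1.
Proof.
rewrite /deg -[RHS](cards1 (inl v : attach_leaves v n)).
by congr #|pred_of_set _|; apply/setP => -[u|b]; rewrite !inE.
Qed.

(* Stated additively to avoid truncated subtraction. *)
Lemma Findex_attach (G : sgraph) (v : G) n :
  Findex (attach_leaves v n) + deg v ^ 3 = Findex G + (deg v + n) ^ 3 + n.
Proof.
rewrite /Findex big_sumType /=.
under [X in _ + X + _]eq_bigr do rewrite deg_attach_leaf exp1n.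
under eq_bigr do rewrite deg_attach_old.
(* Isolate [v], the only old vertex whose degree can change. *)
rewrite sum1_card card_ord (bigD1 v) //= eqxx mul1n [in RHS](bigD1 v) //=.
rewrite (eq_bigr (fun u => deg u ^ 3)) => [|u /negPf ->]; last first.
  by rewrite mul0n addn0.
lia.
Qed.

Lemma deg_triangle (u : triangle) : deg u = 2.
Proof.
rewrite /deg -[2]/(3.-1) -[in RHS](card_ord 3) -(cardC1 u) cardsE.
by apply: eq_card => v; rewrite !inE /= eq_sym.
Qed.

(* The [+ 1] accounts for the pendant vertex that carries the [l] leaves. *)
Lemma Findex_Rgraph i j k l (w : 'I_k) :
  Findex (Rgraph i j k l w) + 1 =
    (2 + i) ^ 3 + (2 + j) ^ 3 + (2 + k) ^ 3 + (1 + l) ^ 3 + (i + j + k + l).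
Proof.
have F3 : Findex triangle = 24.
  rewrite /Findex; under eq_bigr do rewrite deg_triangle.
  by rewrite sum_nat_const card_ord.
have := Findex_attach _ tri_x i.
have := Findex_attach (attach_leaves tri_x i) (inl tri_y) j.
have := Findex_attach (@attach_leaves (attach_leaves tri_x i) (inl tri_y) j)
  (inl (inl tri_z)) k.
have := Findex_attach (@attach_leaves
  (@attach_leaves (attach_leaves tri_x i) (inl tri_y) j)
  (inl (inl tri_z)) k) (inr w) l.
(* [x], [y], [z] are distinct, so each still has degree 2 when its own leaves arrive, and [w] has
   degree 1. *)
rewrite deg_attach_leaf !deg_attach_old !deg_triangle F3 /=.
rewrite !(mul0n, addn0) /Rgraph.
(* [lia] does not identify the nested occurrences of [Findex] by itself. *)
by do 4 move: (Findex _) => ?; lia.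
Qed.

Theorem theorem7 (i k l : nat) (hi : 1 <= i) (hk : 1 <= k) (hl : 1 <= l)
  (w : 'I_k) (w' : 'I_(i + k)) :
  Findex (Rgraph i 0 k l w) < Findex (Rgraph 0 0 (i + k) l w').
Proof.
rewrite -(ltn_add2r 1) !Findex_Rgraph.
(* The second difference of the cube at 2, with increments [i] and [k]. *)
have gap : (2 + 0) ^ 3 + (2 + (i + k)) ^ 3 =
    (2 + i) ^ 3 + (2 + k) ^ 3 + 3 * (i * k * (i + k + 4)) by lia.
have : 0 < i * k * (i + k + 4) by rewrite !muln_gt0 hi hk addn_gt0 orbT.
lia.
Qed.
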